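(* Let $X$ be a commutative hypergroup and let $m$ be an exponential on $X$. Then every moment function on $X$ corresponding to $m$ is an $m$-exponential monomial.
   Context: $X$ is a commutative (locally compact) hypergroup in the sense of the monograph of Bloom and Heyer, with convolution $*$, involution $x\mapsto\check{x}$ and identity $o$; $\delta_x$ denotes the point mass at $x$. $\mathscr{C}(X)$ is the space of all continuous functions $X\to\mathbb{C}$ with the topology of uniform convergence on compact sets. For $f\in\mathscr{C}(X)$ and $x,y\in X$, $f(x*y)=\int_X f\,d(\delta_x*\delta_y)$. The translation by $y$ is $\tau_y f=\delta_{\check{y}}*f$, i.e. $(\tau_y f)(x)=f(x*y)$. A variety is a closed linear subspace of $\mathscr{C}(X)$ invariant under all translations $\tau_y$; the variety of a function is the smallest variety containing it. An exponential is a nonzero continuous function $m:X\to\mathbb{C}$ with $m(x*y)=m(x)m(y)$ for all $x,y\in X$ (so $m(o)=1$). For an exponential $m$ and $y\in X$, $\Delta_{m;y}=\delta_{\check{y}}-m(y)\delta_o$, so that $\Delta_{m;y}*f=\tau_y f-m(y)f$, and $\Delta_{m;y_1,\dots,y_{n+1}}=\Delta_{m;y_1}*\cdots*\Delta_{m;y_{n+1}}$. A continuous function $\varphi:X\to\mathbb{C}$ is a generalized $m$-exponential monomial if there is a natural number $n$ (possibly $0$) such that $\Delta_{m;y_1,\dots,y_{n+1}}*\varphi=0$ for all $y_1,\dots,y_{n+1}\in X$. It is an $m$-exponential monomial if, in addition, its variety is finite dimensional. Multi-indices: $\mathbb{N}=\{0,1,2,\dots\}$; for $\alpha,\beta\in\mathbb{N}^r$,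 $\beta\le\alpha$ means $\beta_i\le\alpha_i$ for all $i$; $\alpha!=\alpha_1!\cdots\alpha_r!$ and $\binom{\alpha}{\beta}=\frac{\alpha!}{\beta!(\alpha-\beta)!}$. For a positive integer $r$, a family of continuous functions $\varphi_\alpha:X\to\mathbb{C}$ $(\alpha\in\mathbb{N}^r)$ is a moment function sequence of rank $r$ if $$\varphi_\alpha(x*y)=\sum_{\beta\le\alpha}\binom{\alpha}{\beta}\varphi_\beta(x)\varphi_{\alpha-\beta}(y)$$ for all $x,y\in X$ and $\alpha\in\mathbb{N}^r$. The sequence corresponds to the exponential $\varphi_0$. A continuous function $\varphi$ is a moment function corresponding to $m$ if there are a positive integer $r$, a moment function sequence $(\varphi_\alpha)_{\alpha\in\mathbb{N}^r}$ of rank $r$ with $\varphi_0=m$, and an $\alpha\in\mathbb{N}^r$ with $\varphi=\varphi_\alpha$. *)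

(* Defs.v *)
From HB Require Import structures.
From mathcomp Require Import all_boot all_order all_algebra.
From mathcomp Require Import all_classical all_reals all_analysis.
From mathcomp Require Import complex.

Set Implicit Arguments.
Unset Strict Implicit.
Unset Printing Implicit Defensive.

Import Order.TTheory GRing.Theory Num.Theory.
Import numFieldNormedType.Exports.

Local Open Scope classical_set_scope.
Local Open Scope ring_scope.

(* [R[i]] packaged as a [numClosedFieldType]: MathComp-Analysis attaches the
   topology of the modulus to the carrier of such a structure. *)
Definition CC (R : realType) : numClosedFieldType := R[i].

(* [borel X] is [X] itself, equipped with its Borel sigma-algebra.  The library
   requires [X] to be pointed; the point is arbitrary (unrelated to the
   identity of a hypergroup) and only records that [X] is nonempty. *)
Notation borel X := (g_sigma_algebraType (@open X)).

Section Measures.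
Context (R : realType) (X : ptopologicalType).
Implicit Type mu : probability (borel X) R.

Definition radon mu :=
  forall A : set (borel X), measurable A ->
    mu A = ereal_sup [set mu K | K in [set K : set X | compact K /\ K `<=` A]].

Definition supp mu : set X :=
  [set x | forall U : set X, open U -> U x -> (0 < mu U)%E].

Definition cintegral mu (f : X -> CC R) : CC R :=
  Complex (Rintegral mu setT (fun x => complex.Re (f x)))
          (Rintegral mu setT (fun x => complex.Im (f x))).

Definition bounded_continuous (f : X -> R) :=
  continuous f /\ exists M : R, forall x, `|f x| <= M.

End Measures.

(* Hypergroups (Bloom-Heyer).  [hg_conv H x y] is delta_x * delta_y.  The
   convolution of arbitrary bounded Radon measures is the bilinear, weakly
   continuous extension
     int f d(mu * nu) = int int (int f d(delta_x * delta_y)) dmu(x) dnu(y),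
   so it is determined by its values on point masses, and [hg_assoc] is
     (delta_x * delta_y) * delta_z = delta_x * (delta_y * delta_z)
   tested against bounded continuous functions.  Measures are compared on
   Borel sets, since the library's measures are also defined off them. *)
Record hypergroup (R : realType) (X : ptopologicalType) := Hypergroup {
  hg_hausdorff : hausdorff_space X ;
  hg_locally_compact : locally_compact [set: X] ;
  hg_conv : X -> X -> probability (borel X) R ;
  hg_radon : forall x y, radon (hg_conv x y) ;
  hg_compact_supp : forall x y, compact (supp (hg_conv x y)) ;
  hg_assoc : forall (x y z : X) (f : X -> R), bounded_continuous f ->
    Rintegral (hg_conv x y) setT (fun u => Rintegral (hg_conv u z) setT f) =
    Rintegral (hg_conv y z) setT (fun v => Rintegral (hg_conv x v) setT f) ;
  (* continuity into the probability measures with the weak topology *)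
  hg_weak_continuous : forall f : X -> R, bounded_continuous f ->
    continuous (fun p : X * X => Rintegral (hg_conv p.1 p.2) setT f) ;
  (* continuity into the compact subsets with the Michael topology, whose
     subbasic open sets are the {C | C meets U and C is included in V} *)
  hg_supp_continuous : forall U V : set X, open U -> open V ->
    open [set p : X * X | supp (hg_conv p.1 p.2) `&` U !=set0
                          /\ supp (hg_conv p.1 p.2) `<=` V] ;
  hg_one : X ;
  hg_conv1l : forall x (A : set (borel X)), measurable A ->
    hg_conv hg_one x A = \d_(x : borel X) A ;
  hg_conv1r : forall x (A : set (borel X)), measurable A ->
    hg_conv x hg_one A = \d_(x : borel X) A ;
  hg_inv : X -> X ;
  hg_inv_continuous : continuous hg_inv ;
  hg_invK : involutive hg_inv ;
  hg_inv_conv : forall x y (A : set (borel X)), measurable A ->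
    hg_conv x y (hg_inv @^-1` A) = hg_conv (hg_inv y) (hg_inv x) A ;
  hg_one_supp : forall x y, supp (hg_conv x y) hg_one <-> x = hg_inv y
}.

Definition hg_commutative (R : realType) (X : ptopologicalType)
    (H : hypergroup R X) :=
  forall x y (A : set (borel X)), measurable A ->
    hg_conv H x y A = hg_conv H y x A.

Section Functions.
Context (R : realType) (X : ptopologicalType) (H : hypergroup R X).
Implicit Types (f g m phi : X -> CC R) (V : set (X -> CC R)).

(* f(x * y) *)
Definition conv_eval f (x y : X) : CC R := cintegral (hg_conv H x y) f.

Definition translation (y : X) f : X -> CC R := fun x => conv_eval f x y.

Definition is_exponential m :=
  [/\ continuous m, exists x, m x != 0
    & forall x y, conv_eval m x y = m x * m y].

Definition Delta m (y : X) f : X -> CC R :=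
  fun x => translation y f x - m y * f x.

(* [Deltas m [:: y1; ...; yk] f] is Delta_{m;y1} * ... * Delta_{m;yk} * f. *)
Definition Deltas m (ys : seq X) f : X -> CC R := foldr (Delta m) f ys.

Definition linear_subspace V :=
  V (fun=> 0) /\
  forall (a : CC R) f g, V f -> V g -> V (fun x => a * f x + g x).

(* closed in the space of continuous functions, for the topology of uniform
   convergence on compact sets *)
Definition closed_in_continuous V :=
  exists2 F : set {family compact, X -> CC R},
    closed F & V = [set f | F f /\ continuous f].

Definition is_variety V :=
  [/\ closed_in_continuous V, linear_subspace V
    & forall y f, V f -> V (translation y f)].

Definition variety_of phi : set (X -> CC R) :=
  [set f | forall V, is_variety V -> V phi -> V f].

Definition finite_dimensional V :=
  exists n (g : 'I_n -> X -> CC R),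
    (forall i, V (g i)) /\
    forall f, V f -> exists c : 'I_n -> CC R,
      forall x, f x = \sum_(i < n) c i * g i x.

Definition generalized_exponential_monomial m phi :=
  continuous phi /\
  exists n : nat, forall ys : n.+1.-tuple X,
    forall x, Deltas m ys phi x = 0.

Definition exponential_monomial m phi :=
  generalized_exponential_monomial m phi /\
  finite_dimensional (variety_of phi).

End Functions.

Section MultiIndices.
Context (r : nat).

Definition multi_index := {ffun 'I_r -> nat}.
Implicit Types a b : multi_index.

Definition mi_zero : multi_index := [ffun=> 0%N].
Definition mi_sub a b : multi_index := [ffun i => (a i - b i)%N].
Definition mi_fact a : nat := (\prod_(i < r) (a i)`!)%N.

(* The division is exact when b <= a. *)
Definition mi_binomial a b : nat :=
  (mi_fact a %/ (mi_fact b * mi_fact (mi_sub a b)))%N.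

(* [mi_below a] enumerates the multi-indices b <= a. *)
Definition mi_below a := {dffun forall i : 'I_r, 'I_(a i).+1}.
Definition mi_of_below a (b : mi_below a) : multi_index :=
  [ffun i => nat_of_ord (b i)].

End MultiIndices.

Section Moments.
Context (R : realType) (X : ptopologicalType) (H : hypergroup R X).

Definition moment_sequence (r : nat) (phi : multi_index r -> X -> CC R) :=
  (forall a, continuous (phi a)) /\
  forall (a : multi_index r) (x y : X),
    conv_eval H (phi a) x y =
    \sum_(b : mi_below a) (mi_binomial a (mi_of_below b))%:R
      * phi (mi_of_below b) x * phi (mi_sub a (mi_of_below b)) y.

Definition moment_function (m phi : X -> CC R) :=
  exists r : nat, (0 < r)%N /\
  exists phis : multi_index r -> X -> CC R,
    [/\ moment_sequence phis, phis (mi_zero r) = m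
      & exists a : multi_index r, phi = phis a].

End Moments.

(* Main.v *)
Require Import Defs.
From mathcomp Require Import all_boot all_order all_algebra.
From mathcomp Require Import all_classical all_reals all_analysis.
From mathcomp Require Import finmap measurable_realfun complex.

(** Let [(phi_b)] be a moment sequence with [phi_0 = m], and fix a
    multi-index [a].  As a function of [x], the moment identity expands
    [translation y (phi_b)] in the [phi_c] with [c <= b]; the coefficient of
    the top term [phi_b] is [phi_0(y) = m(y)], and every other [c] has a
    smaller total degree.  Both halves of the claim follow.

    - Subtracting [m(y) phi_b] removes the top term, so [Delta m y] maps the
      span of the [phi_b] with [b <= a] and degree below [k+1] into the same
      span with bound [k] ([Delta_moments_below]).  After [|a| + 1]
      applications nothing is left of [phi_a].
    - The span of all the [phi_b] with [b <= a] is invariant under translation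
      and finite dimensional.  Once it is known to be closed, it is a variety
      containing [phi_a], hence it contains the variety of [phi_a], which is
      then finite dimensional as a subspace.

    Two points need an argument.  First, translations are linear only on
    functions that can be integrated against [delta_x * delta_y]; continuous
    functions can, because a Radon measure does not charge the complement of
    its support ([radon_suppC]) and the supports here are compact.
    Second, closedness and the passage to a subspace both rest on
    [interpolation_basis]: a subspace [V] of a finite-dimensional space of
    functions contains a finite family [e] for which there are points [p] with
    [f = \sum_i f(p_i) e_i] on [V].  That formula is a pointwise closed
    condition on [f], so [V] is closed even for pointwise convergence. *)

Import Order.TTheory GRing.Theory Num.Theory.
Import numFieldNormedType.Exports.

Set Implicit Arguments.
Unset Strict Implicit.
Unset Printing Implicit Defensive.

Local Open Scope classical_set_scope.
Local Open Scope ring_scope.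

(** * Integration of continuous complex functions *)

Section ComplexParts.
Context (R : realType) (X : topologicalType).
Implicit Type f : X -> CC R.

Lemma norm_Im_le (z : R[i]) : (`|complex.Im z|%:C)%C <= `|z|.
Proof.
by case: z => a b; simpc; rewrite -sqrtr_sqr ler_wsqrtr // lerDr sqr_ge0.
Qed.

(** The topology of [CC R] comes from the modulus, itself an element of [CC R],
    so a real part is continuous because it is additive and dominated by the
    modulus. *)
Lemma continuous_real_part (p : {additive R[i] -> R}) f :
  (forall z : R[i], (`|p z|%:C)%C <= `|z|) ->
  continuous f -> continuous (fun x => p (f x) : R).
Proof.
move=> p_le fc x; apply/cvgrPdist_lt => e e0.
have e0' : 0 < (e%:C)%C :> CC R by rewrite ltcR.
have := fc x => /cvgrPdist_lt /(_ _ e0'); apply: filterS => t.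
rewrite -raddfB -ltcR; exact: le_lt_trans.
Qed.

Lemma continuous_Re f : continuous f ->
  continuous (fun x => complex.Re (f x) : R).
Proof. exact: (continuous_real_part (@normc_ge_Re R)). Qed.

Lemma continuous_Im f : continuous f ->
  continuous (fun x => complex.Im (f x) : R).
Proof. exact: (continuous_real_part norm_Im_le). Qed.

End ComplexParts.

Section Integration.
Context (R : realType) (X : ptopologicalType).
Implicit Type mu : probability (borel X) R.

Lemma open_borel (U : set X) : open U -> measurable (U : set (borel X)).
Proof. exact: sub_sigma_algebra. Qed.

Lemma continuous_borel (f : X -> R) :
  continuous f -> measurable_fun setT (f : borel X -> R).
Proof.
move=> /continuousP cf; apply: (measurability _ (RGenOpens.measurableE R)).
move=> _ [_ [a [b ->] <-]]; rewrite setTI; apply: open_borel.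
exact/cf/interval_open.
Qed.

(** Without second countability this union may be uncountable, so it does not
    follow at once that the complement of the support is a null set. *)
Lemma suppCE mu :
  ~` supp mu = \bigcup_(U in [set U : set X | open U /\ mu U = 0%E]) U.
Proof.
apply/seteqP; split=> [x /existsNP[U /not_implyP[Uo /not_implyP[Ux /negP]]]|].
  rewrite -leNgt measure_le0 => /eqP U0; exists U => //.
by move=> x [U [Uo U0] Ux] /(_ U Uo Ux); rewrite U0 ltxx.
Qed.

Lemma open_suppC mu : open (~` supp mu).
Proof. by rewrite suppCE; apply: bigcup_open => U []. Qed.

(** By inner regularity only compact subsets matter, and such a set is covered
    by finitely many open null sets. *)
Lemma radon_suppC mu : hausdorff_space X -> radon mu -> mu (~` supp mu) = 0%E.
Proof.
move=> hX muR; rewrite muR; last exact: (open_borel (open_suppC mu)).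
apply/eqP; rewrite eq_le; apply/andP; split; last first.
  apply: ereal_sup_ubound; rewrite -(measure0 mu).
  by apply: imageP; split => //; exact: compact0.
apply: ge_ereal_sup => _ [K [cK Ksub] <-].
have mK : measurable (K : set (borel X)).
  rewrite -[K]setCK; apply: measurableC; apply: open_borel.
  exact: (closed_openC (compact_closed hX cK)).
have [D Dsub KD] : finite_subset_cover
    [set U : set X | open U /\ mu U = 0%E] id K.
  move: cK; rewrite compact_cover; apply; first by move=> U [].
  by apply: subset_trans Ksub _; rewrite suppCE.
have D0 (U : set X) : [set` D] U -> open U /\ mu U = 0%E.
  by move=> /Dsub/set_mem.
apply: le_trans (@content_sub_fsum _ _ _ mu _ [set` D] K id _ _ mK KD) _ => //.
- by move=> U /D0[Uo _]; exact: open_borel.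
- by rewrite fsbig1// => U /D0[].
Qed.

(** A continuous function may be unbounded on [X], but it is bounded on the
    support, which carries all the mass. *)
Lemma continuous_integrable mu (f : X -> R) :
  hausdorff_space X -> radon mu -> compact (supp mu) -> continuous f ->
  mu.-integrable setT (EFin \o f).
Proof.
move=> hX muR muc fc; have mf := continuous_borel fc.
have mSC : measurable (~` supp mu : set (borel X)).
  exact: (open_borel (open_suppC mu)).
apply/(negligible_integrable mSC) => //; [exact/measurable_EFinP
                                         |exact: radon_suppC|].
have mS : measurable (supp mu : set (borel X)).
  by rewrite -[supp mu]setCK; exact: measurableC.
rewrite setTD setCK; apply: measurable_bounded_integrable => //.
- by rewrite (le_lt_trans (probability_le1 _ _))// ltry.
- exact: measurable_funS mf.
have : bounded_set (f @` supp mu).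
  by apply: compact_bounded; apply: continuous_compact => //;
    exact: continuous_subspaceT.
case=> M [Mr MP]; exists M; split => // N /MP fN x Sx.
by apply: fN; exists x.
Qed.

Lemma cintegral_linear mu (a : CC R) (f g : X -> CC R) :
  hausdorff_space X -> radon mu -> compact (supp mu) ->
  continuous f -> continuous g ->
  cintegral mu (fun x => a * f x + g x) = a * cintegral mu f + cintegral mu g.
Proof.
move=> hX muR muc fc gc.
have int (h : X -> R) : continuous h -> mu.-integrable setT (EFin \o h).
  exact: continuous_integrable.
have ifr := int _ (continuous_Re fc); have ifi := int _ (continuous_Im fc).
have igr := int _ (continuous_Re gc); have igi := int _ (continuous_Im gc).
have cZ (c : R) (h : X -> R) : continuous h -> continuous (fun x => c * h x).
  by move=> hc x; apply: cvgM; [exact: cvg_cst|exact: hc].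
rewrite /cintegral; case: a => p q.
have -> : (fun x => complex.Re (Complex p q * f x + g x : CC R)) =
    (fun x => (p * complex.Re (f x) - q * complex.Im (f x)) +
              complex.Re (g x)).
  by apply/funext => x; case: (f x) (g x) => ? ? [].
have -> : (fun x => complex.Im (Complex p q * f x + g x : CC R)) =
    (fun x => (p * complex.Im (f x) + q * complex.Re (f x)) +
              complex.Im (g x)).
  by apply/funext => x; case: (f x) (g x) => ? ? [].
have cRe := continuous_Re fc; have cIm := continuous_Im fc.
have iRe : mu.-integrable setT
    (EFin \o (fun x => p * complex.Re (f x) - q * complex.Im (f x))).
  by apply: int => x; apply: cvgB; exact: cZ.
have iIm : mu.-integrable setT
    (EFin \o (fun x => p * complex.Im (f x) + q * complex.Re (f x))).
  by apply: int => x; apply: cvgD; exact: cZ.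
rewrite RintegralD// RintegralB//; try exact: int (cZ _ _ _).
rewrite !RintegralD//; try exact: int (cZ _ _ _).
by rewrite !RintegralZl.
Qed.

End Integration.

(** * Finite-dimensional spaces of functions *)

Lemma family_compact_eval_continuous (U : topologicalType) (V : uniformType)
    (x : U) : continuous (fun f : {family compact, U -> V} => f x : V).
Proof.
move=> f A; rewrite -nbhs_entourageE => -[E entE EA].
have cx : compact [set x] by exact: compact_set1.
have := fam_nbhs f entE cx.
by apply: filterS => g /(_ x erefl) /xsectionP/EA.
Qed.

(** Meant for a function space [T], with evaluations for the [u i] and [v]. *)
Lemma closed_linear_equation (T : topologicalType) (K : numFieldType) (k : nat)
    (u : 'I_k -> T -> K) (c : 'I_k -> K) (v : T -> K) :
  (forall i, continuous (u i)) -> continuous v ->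
  closed [set t | \sum_(i < k) u i t * c i - v t = 0].
Proof.
move=> uc vc; apply: (preimage_closed (D := [set 0])); last first.
  exact/accessible_closed_set1/hausdorff_accessible/norm_hausdorff.
move=> t _; apply: cvgB; last exact: vc.
apply: cvg_big => [|i _]; first exact: add_continuous.
by apply: cvgM; [exact: uc|exact: cvg_cst].
Qed.

Section LinearSubspaces.
Context (R : realType) (X : ptopologicalType).
Implicit Types (V : set (X -> CC R)) (f g : X -> CC R).

Definition span (G : set (X -> CC R)) := smallest (@linear_subspace R X) G.

Lemma linear_subspace_span G : linear_subspace (span G).
Proof.
split=> [V [[]]//|a f g Gf Gg V VG].
by apply: (VG.1.2); [exact: Gf|exact: Gg].
Qed.

Lemma span_sub (G G' : set (X -> CC R)) :
  G `<=` span G' -> span G `<=` span G'.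
Proof. exact: (smallest_sub (linear_subspace_span G')). Qed.

Lemma linear_subspace_sum V (I : finType) (P : pred I) (c : I -> CC R)
    (g : I -> X -> CC R) :
  linear_subspace V -> (forall i, P i -> V (g i)) ->
  V (fun x => \sum_(i | P i) c i * g i x).
Proof.
move=> [V0 VD] Vg; elim: (index_enum I) => [|i s IH].
  by have -> : (fun x => \sum_(i <- [::] | P i) c i * g i x) = fun=> 0
    by apply/funext => x; rewrite big_nil.
case Pi: (P i); last first.
  have -> // : (fun x => \sum_(j <- i :: s | P j) c j * g j x) =
    fun x => \sum_(j <- s | P j) c j * g j x.
  by apply/funext => x; rewrite big_cons Pi.
have -> : (fun x => \sum_(j <- i :: s | P j) c j * g j x) =
    fun x => c i * g i x + \sum_(j <- s | P j) c j * g j x.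
  by apply/funext => x; rewrite big_cons Pi.
by apply: VD => //; exact: Vg.
Qed.

Lemma span_fin (I : finType) (g : I -> X -> CC R) f :
  span (range g) f -> exists c : I -> CC R, forall x, f x = \sum_i c i * g i x.
Proof.
apply: (smallest_sub (X := [set f | exists c : I -> CC R,
  forall x, f x = \sum_i c i * g i x])).
  split=> [|a h k [c hE] [d kE]].
    by exists (fun=> 0) => x; rewrite big1// => i _; rewrite mul0r.
  exists (fun i => a * c i + d i) => x; rewrite hE kE mulr_sumr -big_split/=.
  by apply: eq_bigr => i _; rewrite mulrDl mulrA.
move=> _ [i _ <-]; exists (fun j => (j == i)%:R) => x.
by rewrite (bigD1 i)//= eqxx mul1r big1 ?addr0// => j /negPf->; rewrite mul0r.
Qed.

Definition biorthogonal k (p : 'I_k -> X) (e : 'I_k -> X -> CC R) :=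
  forall i j, e i (p j) = (i == j)%:R.

(** Writing [e] in terms of [g] and evaluating at [p] factors the identity
    matrix of size [k] through dimension [#|I|]. *)
Lemma biorthogonal_le_size k p (e : 'I_k -> X -> CC R) (I : finType)
    (g : I -> X -> CC R) :
  biorthogonal p e -> (forall i, span (range g) (e i)) -> (k <= #|I|)%N.
Proof.
move=> pe eg; have [c cE] := choice (fun i => span_fin (eg i)).
pose C := \matrix_(i < k, j < #|I|) c i (enum_val j).
pose G := \matrix_(j < #|I|, i < k) g (enum_val j) (p i).
have CG : C *m G = 1%:M.
  apply/matrixP => i j; rewrite !mxE -pe cE.
  rewrite [RHS](eq_bigl (mem I))// [RHS]big_enum_val.
  by apply: eq_bigr => l _; rewrite !mxE.
by rewrite -(mxrank1 (CC R) k) -CG mulmx_max_rank.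
Qed.

(** Take a biorthogonal family in [V] of the largest possible size.  If some
    [f] in [V] differed at [x0] from the combination of the [e i] with the same
    values at the [p i], the difference, normalised at [x0], would extend the
    family by one. *)
Lemma interpolation_basis V (I : finType) (g : I -> X -> CC R) :
  linear_subspace V -> V `<=` span (range g) ->
  exists k (p : 'I_k -> X) (e : 'I_k -> X -> CC R), (forall i, V (e i)) /\
    forall f, V f -> forall x, f x = \sum_(i < k) f (p i) * e i x.
Proof.
move=> Vlin Vg; have [V0 VD] := Vlin.
pose P k := `[< exists (p : 'I_k -> X) (e : 'I_k -> X -> CC R),
  (forall i, V (e i)) /\ biorthogonal p e >].
have P0 : exists k, P k.
  exists 0%N; apply/asboolP.
  by exists (fun=> point), (fun=> fun=> 0); split; case.
have Pb k : P k -> (k <= #|I|)%N.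
  move=> /asboolP[p [e [Ve pe]]]; apply: biorthogonal_le_size pe _ => i.
  exact: (Vg _ (Ve i)).
have [k /asboolP[p [e [Ve pe]]] kmax] := ex_maxnP P0 Pb.
exists k, p, e; split => // f Vf x0; apply: contrapT => fx0.
pose h x := \sum_(i < k) (- f (p i)) * e i x + f x.
have Vh : V h.
  have := VD 1 _ _ (linear_subspace_sum (P := predT) (fun i => - f (p i)) Vlin
    (fun i _ => Ve i)) Vf.
  by congr V; apply/funext => x; rewrite mul1r.
have hp j : h (p j) = 0.
  rewrite /h (bigD1 j)//= pe eqxx mulr1 big1 ?addr0 ?addNr// => i /negPf ij.
  by rewrite pe ij mulr0.
have hx0 : h x0 != 0.
  apply/eqP => h0; apply: fx0; move: h0; rewrite /h.
  under eq_bigr do rewrite mulNr; rewrite sumrN addrC => /eqP.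
  by rewrite subr_eq0 => /eqP.
suff /kmax : P k.+1 by rewrite ltnn.
apply/asboolP; exists (fun i => oapp p x0 (unlift ord0 i)).
(* Subtracting a multiple of [h] makes the old functions vanish at [x0].  The
   summand [0] gives both branches the form [a * f + g] of the closure
   condition in [linear_subspace]. *)
pose e' i x := if unlift ord0 i is Some j then (- e j x0 / h x0) * h x + e j x
  else (h x0)^-1 * h x + 0.
exists e'; split => [i|i j]; rewrite /e'.
  by case: (unlift ord0 i) => [j|]; apply: VD.
case: unliftP => [i' ->|->]; case: unliftP => [j' ->|->] /=.
- by rewrite hp mulr0 add0r pe (inj_eq lift_inj).
- by rewrite divfK// addNr.
- by rewrite hp mulr0 addr0.
- by rewrite mulVf// addr0.
Qed.

(** [finite_dimensional V] asks for generators inside [V], whereas the [g i]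
    may lie outside it. *)
Lemma finite_dimensional_sub V (I : finType) (g : I -> X -> CC R) :
  linear_subspace V -> V `<=` span (range g) -> finite_dimensional V.
Proof.
move=> Vlin /(interpolation_basis Vlin)[k [p [e [Ve Vp]]]].
by exists k, e; split => // f /Vp fE; exists (fun i => f (p i)).
Qed.

Lemma linear_subspace_continuous :
  linear_subspace [set f : X -> CC R | continuous f].
Proof.
split=> [|a f g fc gc] x; first exact: cvg_cst.
by apply: cvgD; [apply: cvgM; [exact: cvg_cst|exact: fc]|exact: gc].
Qed.

Lemma span_continuous (G : set (X -> CC R)) :
  G `<=` (fun f => continuous f) -> span G `<=` (fun f => continuous f).
Proof. exact: (smallest_sub linear_subspace_continuous). Qed.

(** In an interpolation basis, membership in the span is the family of
    equations [f x = \sum_i f(p_i) e_i(x)], each involving finitely many values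
    of [f]. *)
Lemma span_closed (I : finType) (g : I -> X -> CC R) :
  (forall i, continuous (g i)) -> closed_in_continuous (span (range g)).
Proof.
move=> gc; set V := span _.
have Vlin : linear_subspace V := linear_subspace_span _.
have [k [p [e [Ve Vp]]]] := interpolation_basis Vlin (@subset_refl _ V).
exists V; last first.
  apply/seteqP; split=> [f Vf|f []//]; split=> //.
  apply: span_continuous Vf.
  by move=> _ [i _ <-]; exact: gc.
have -> : V = \bigcap_(x : X)
    [set f | (\sum_(i < k) f (p i) * e i x) - f x = 0].
  apply/seteqP; split=> [f Vf x _ /=|f fE].
    by rewrite -Vp// subrr.
  have -> : f = fun x => \sum_(i < k) f (p i) * e i x.
    by apply/funext => x; have /eqP := fE x Logic.I; rewrite subr_eq0 => /eqP.
  exact: linear_subspace_sum.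
apply: closed_bigI => x _.
apply: (@closed_linear_equation _ (CC R) k
  (fun i (f : {family compact, X -> CC R}) => f (p i)) (e ^~ x)
  (fun f : {family compact, X -> CC R} => f x)) => [i|];
  exact: family_compact_eval_continuous.
Qed.

End LinearSubspaces.

(** * Translations and varieties *)

Section Translation.
Context (R : realType) (X : ptopologicalType) (H : hypergroup R X).
Implicit Types (f g m : X -> CC R) (V W : set (X -> CC R)).

Lemma translation_linear y (a : CC R) f g : continuous f -> continuous g ->
  translation H y (fun x => a * f x + g x) =
  (fun x => a * translation H y f x + translation H y g x).
Proof.
move=> fc gc; apply/funext => x; apply: cintegral_linear => //.
- exact: hg_hausdorff H.
- exact: hg_radon.
- exact: hg_compact_supp.
Qed.

Lemma Delta_linear m y (a : CC R) f g : continuous f -> continuous g ->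
  Delta H m y (fun x => a * f x + g x) =
  (fun x => a * Delta H m y f x + Delta H m y g x).
Proof.
move=> fc gc; apply/funext => x; rewrite /Delta translation_linear//.
by rewrite mulrDr !mulrBr opprD addrACA mulrCA.
Qed.

(** Lets statements on [Delta] specialise to translations. *)
Lemma Delta0E y : Delta H (fun=> 0) y = translation H y.
Proof. by apply/funext => f; apply/funext => x; rewrite /Delta mul0r subr0. Qed.

(** Linearity of [Delta m y] needs integrable functions, so the induction on
    the span must carry continuity along. *)
Lemma Delta_span m y (G : set (X -> CC R)) W :
  linear_subspace W -> G `<=` (fun f => continuous f) ->
  (forall f, G f -> W (Delta H m y f)) ->
  forall f, span G f -> W (Delta H m y f).
Proof.
move=> [W0 WD] Gc GW f Gf.
suff [] : [set f | continuous f /\ W (Delta H m y f)] f by [].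
apply: smallest_sub Gf => [|h Gh]; last by split; [exact: Gc|exact: GW].
have [C0 CD] := linear_subspace_continuous R X.
split=> [|a h k [hc Wh] [kc Wk]].
  split=> //; have -> // : Delta H m y (fun=> 0) = fun=> 0.
  have := Delta_linear m y (-1) C0 C0.
  have -> : (fun x : X => -1 * 0 + 0 : CC R) = fun=> 0.
    by apply/funext => x; rewrite mulr0 addr0.
  by move=> ->; apply/funext => x; rewrite mulN1r addNr.
split; first exact: (CD a h k hc kc).
by rewrite Delta_linear//; exact: WD.
Qed.

Lemma translation_span y (G : set (X -> CC R)) W :
  linear_subspace W -> G `<=` (fun f => continuous f) ->
  (forall f, G f -> W (translation H y f)) ->
  forall f, span G f -> W (translation H y f).
Proof. by rewrite -Delta0E; exact: Delta_span. Qed.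

Lemma linear_subspace_variety_of phi :
  linear_subspace (variety_of H phi).
Proof.
split=> [V [_ [V0 _] _]//|a f g fV gV V Vvar Vphi].
by case: (Vvar) => _ [_ VD] _; apply: VD; [exact: fV|exact: gV].
Qed.

(** The span of [g] is itself a variety, so it contains that of [phi]. *)
Lemma finite_dimensional_variety_of (I : finType) (g : I -> X -> CC R) phi :
  (forall i, continuous (g i)) ->
  (forall y i, span (range g) (translation H y (g i))) ->
  span (range g) phi -> finite_dimensional (variety_of H phi).
Proof.
move=> gc gtr gphi; apply: (finite_dimensional_sub (g := g)).
  exact: linear_subspace_variety_of.
move=> f; apply => //; split; [exact: span_closed|exact: linear_subspace_span|].
move=> y; apply: translation_span; first exact: linear_subspace_span.
  by move=> _ [i _ <-]; exact: gc.
by move=> _ [i _ <-]; exact: gtr.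
Qed.

End Translation.

(** * Multi-indices *)

Section MultiIndexOrder.
Context (r : nat).
Implicit Types a b : multi_index r.

Definition mi_le a b := forall i, (a i <= b i)%N.
Definition mi_degree a : nat := (\sum_i a i)%N.

Lemma mi_le_trans a b c : mi_le a b -> mi_le b c -> mi_le a c.
Proof. by move=> ab bc i; exact: leq_trans (ab i) (bc i). Qed.

Lemma mi_lt_degree a b : mi_le a b -> a <> b -> (mi_degree a < mi_degree b)%N.
Proof.
move=> ab; apply: contra_notT; rewrite -leqNgt => ba; apply/ffunP => i.
have /leqif_sum/leqifP : forall i, xpredT i ->
    (a i <= b i ?= iff (a i == b i))%N.
  by move=> j _; exact/leqif_eq/ab.
rewrite ltnNge ba; case: forallP => // /(_ i)/eqP->//.
Qed.

Lemma mi_of_below_le a (b : mi_below a) : mi_le (mi_of_below b) a.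
Proof. by move=> i; rewrite ffunE -ltnS ltn_ord. Qed.

Lemma mi_of_below_inj a : injective (@mi_of_below r a).
Proof.
move=> b c /ffunP bc; apply/ffunP => i; apply/val_inj.
by have := bc i; rewrite !ffunE.
Qed.

Lemma mi_le_below a b : mi_le b a -> exists c : mi_below a, mi_of_below c = b.
Proof.
move=> ba; exists [ffun i => inord (b i)]; apply/ffunP => i.
by rewrite !ffunE inordK// ltnS.
Qed.

Lemma mi_sub_self a : mi_sub a a = mi_zero r.
Proof. by apply/ffunP => i; rewrite !ffunE subnn. Qed.

Lemma mi_binomial_self a : mi_binomial a a = 1%N.
Proof.
rewrite /mi_binomial mi_sub_self {3}/mi_fact big1 => [|i _].
  by rewrite muln1 divnn prodn_gt0// => i; exact: fact_gt0.
by rewrite ffunE.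
Qed.

End MultiIndexOrder.

(** * Moment sequences *)

Section MomentSequences.
Context (R : realType) (X : ptopologicalType) (H : hypergroup R X) (r : nat).
Context (phi : multi_index r -> X -> CC R) (phi_moment : moment_sequence H phi).
Implicit Types a b : multi_index r.

(** The bound on the degree is strict, so that nothing lies below [0]. *)
Definition moments_below a (k : nat) : set (X -> CC R) :=
  phi @` [set b | mi_le b a /\ (mi_degree b < k)%N].

Lemma moments_below_continuous a k :
  moments_below a k `<=` (fun f => continuous f).
Proof. by move=> _ [b _ <-]; exact: phi_moment.1. Qed.

Lemma translation_momentE y b :
  translation H y (phi b) = fun x => \sum_(c : mi_below b)
    (mi_binomial b (mi_of_below c))%:R * phi (mi_sub b (mi_of_below c)) y
      * phi (mi_of_below c) x.
Proof.
apply/funext => x; rewrite /translation phi_moment.2.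
by apply: eq_bigr => c _; rewrite mulrAC.
Qed.

Lemma translation_moment y b :
  span (range (fun c : mi_below b => phi (mi_of_below c)))
    (translation H y (phi b)).
Proof.
rewrite translation_momentE.
apply: linear_subspace_sum; first exact: linear_subspace_span.
by move=> i _; apply: sub_gen_smallest; exists i.
Qed.

(** The term [c = b] of the moment identity is [phi b x * phi 0 y], exactly
    what [Delta] subtracts; the remaining [c] have smaller degree. *)
Lemma Delta_moment y a b : mi_le b a ->
  span (moments_below a (mi_degree b)) (Delta H (phi (mi_zero r)) y (phi b)).
Proof.
move=> ba; have [top topE] := mi_le_below (fun i => leqnn (b i)).
have -> : Delta H (phi (mi_zero r)) y (phi b) = fun x => \sum_(c | c != top)
    (mi_binomial b (mi_of_below c))%:R * phi (mi_sub b (mi_of_below c)) y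
      * phi (mi_of_below c) x.
  apply/funext => x; rewrite /Delta translation_momentE (bigD1 top)//= topE.
  by rewrite mi_binomial_self mi_sub_self mul1r addrAC subrr add0r.
apply: linear_subspace_sum; first exact: linear_subspace_span.
move=> c c_top; apply: sub_gen_smallest; exists (mi_of_below c) => //; split.
  exact: mi_le_trans (mi_of_below_le c) ba.
apply: mi_lt_degree (mi_of_below_le c) _ => cb.
by move/eqP: c_top; apply; apply: mi_of_below_inj; rewrite cb topE.
Qed.

Lemma Delta_moments_below y a k f : span (moments_below a k.+1) f ->
  span (moments_below a k) (Delta H (phi (mi_zero r)) y f).
Proof.
apply: Delta_span; [exact: linear_subspace_span|
                    exact: moments_below_continuous|].
move=> _ [b [ba bk] <-]; refine (span_sub _ (Delta_moment y ba)).
move=> _ [c [ca cb] <-]; apply: sub_gen_smallest.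
by exists c => //; split=> //; exact: leq_trans cb bk.
Qed.

Lemma Deltas_moments_below ys a k f : span (moments_below a (k + size ys)) f ->
  span (moments_below a k) (Deltas H (phi (mi_zero r)) ys f).
Proof.
elim: ys k => [|y ys IH] k; first by rewrite addn0.
by rewrite /= addnS -addSn => /IH/Delta_moments_below; exact.
Qed.

Lemma moments_below_degree0 a f : span (moments_below a 0) f -> f = fun=> 0.
Proof.
apply: (smallest_sub (X := [set f | f = fun=> 0])) => [|_ [b []//]].
by split=> // c g h -> ->; apply/funext => x; rewrite mulr0 addr0.
Qed.

Lemma moment_exponential_monomial a :
  exponential_monomial H (phi (mi_zero r)) (phi a).
Proof.
split.
  split; first exact: phi_moment.1.
  exists (mi_degree a) => ys x.
  rewrite (@moments_below_degree0 a (Deltas _ _ _ _))//.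
  apply: Deltas_moments_below; rewrite add0n size_tuple.
  by apply: sub_gen_smallest; exists a => //; split=> // i.
apply: (finite_dimensional_variety_of
  (g := fun c : mi_below a => phi (mi_of_below c))).
- by move=> c; exact: phi_moment.1.
- move=> y b; have below_sub :
      range (fun c : mi_below (mi_of_below b) => phi (mi_of_below c)) `<=`
      span (range (fun c : mi_below a => phi (mi_of_below c))).
    move=> _ [c _ <-]; have [d dE] := mi_le_below
      (mi_le_trans (mi_of_below_le c) (mi_of_below_le b)).
    by apply: sub_gen_smallest; exists d => //; rewrite dE.
  by apply: (span_sub below_sub); exact: translation_moment.
- have [top topE] := mi_le_below (fun i => leqnn (a i)).
  by apply: sub_gen_smallest; exists top => //; rewrite topE.
Qed.

End MomentSequences.

Theorem theorem1p1 (R : realType) (X : ptopologicalType) (H : hypergroup R X)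
    (Hcomm : hg_commutative H) (m : X -> CC R) (Hm : is_exponential H m)
    (phi : X -> CC R) (Hphi : moment_function H m phi) :
  exponential_monomial H m phi.
Proof.
have [r [_ [phis [phis_moment <- [a ->]]]]] := Hphi.
exact: moment_exponential_monomial.
Qed.
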